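(* Every nonzero commutative Banach algebra is not biamenable.
   Context: Let $A$ be a Banach algebra. A Banach $A$-bimodule is a Banach space $X$ which is an $A$-bimodule with continuous module operations. Its dual $X^*$ is a Banach $A$-bimodule via $(a\cdot f)(x)=f(xa)$ and $(f\cdot a)(x)=f(ax)$. A derivation $d:A\to X$ is a bounded linear map with $d(ab)=d(a)b+a\,d(b)$. A biderivation $D:A\times A\to X$ is a bounded bilinear map such that for all $a,b\in A$ the maps $D(a,\cdot)$ and $D(\cdot,b)$ are derivations $A\to X$. Put $Z(A,X)=\{x\in X: ax=xa\ \ \forall a\in A\}$. For $x\in Z(A,X)$ the map $\Delta_x(a,b)=x[a,b]=x(ab-ba)$ is called an inner biderivation. $A$ is called biamenable if for every Banach $A$-bimodule $X$ every biderivation $D:A\times A\to X^*$ is inner, i.e. $D=\Delta_\phi$ for some $\phi\in Z(A,X^* )$. *)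

(* Defs.v *)
From HB Require Import structures.
From mathcomp Require Import all_boot all_order all_algebra complex.
From mathcomp Require Import all_classical all_reals all_analysis.
From mathcomp Require Import ring.

Set Implicit Arguments.
Unset Strict Implicit.
Unset Printing Implicit Defensive.

Import Order.TTheory GRing.Theory Num.Theory.
Import numFieldNormedType.Exports.

Local Open Scope classical_set_scope.
Local Open Scope ring_scope.

(* Banach spaces are taken over a field K which is either a realType R or its
   complexification R[i]. The structure scalarFieldType is only there to treat
   both at once: norms take values in K, so defining the operator norm of a
   functional as a supremum in K requires that bounded sets of nonnegative
   elements of K have one, and completeness of duals that K is complete. *)
HB.mixin Record NumField_isScalarField K & Num.NumField K := {
  scalar_sup : forall S : set K, (forall x, S x -> 0 <= x) ->
    S !=set0 -> ubound S !=set0 -> supremums S !=set0;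
  scalar_complete : forall F : set_system K^o,
    ProperFilter F -> cauchy F -> cvg F
}.

#[short(type="scalarFieldType")]
HB.structure Definition ScalarField :=
  {K of Num.NumField K & NumField_isScalarField K}.

Lemma real_scalar_sup (R : realType) (S : set R) : (forall x, S x -> 0 <= x) ->
  S !=set0 -> ubound S !=set0 -> supremums S !=set0.
Proof.
move=> _ S0 Sb; exists (sup S); split.
  by apply: ub_le_sup.
by move=> y; apply: ge_sup.
Qed.

#[non_forgetful_inheritance]
HB.instance Definition _ (R : realType) :=
  NumField_isScalarField.Build R (@real_scalar_sup R) (@R_complete R).

Lemma complex_scalar_sup (R : realType) (S : set R[i]) :
  (forall x, S x -> 0 <= x) ->
  S !=set0 -> ubound S !=set0 -> supremums S !=set0.
Proof.
move=> S0 [x0 Sx0] [M SM].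
have ImS x : S x -> x = (complex.Re x)%:C%C.
  by move=> /S0; case: x => a b; rewrite lecE/= => /andP[/eqP-> _].
have /(@real_scalar_sup R)[] : forall x, (@complex.Re R @` S) x -> 0 <= x.
- by move=> _ [x /S0 + <-]; rewrite lecE => /andP[].
- by exists (complex.Re x0), x0.
- by exists (complex.Re M) => _ [x /SM + <-]; rewrite lecE => /andP[].
move=> s [s1 s2]; exists s%:C%C; split.
  by move=> x Sx; rewrite (ImS _ Sx) lecR; apply: s1; exists x.
move=> y Sy; rewrite lecE /= ; apply/andP; split.
  by have := Sy _ Sx0; rewrite {1}(ImS _ Sx0) lecE /= => /andP[].
by apply: s2 => _ [x /Sy + <-]; rewrite lecE => /andP[].
Qed.

Lemma complex_ge_Im (R : realType) (x : R[i]) : `|complex.Im x|%:C%C <= `|x|.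
Proof.
by rewrite normc_def lecR -sqrtr_sqr ler_wsqrtr// lerDr sqr_ge0.
Qed.

Lemma complex_scalar_complete (R : realType) (F : set_system R[i]^o) :
  ProperFilter F -> cauchy F -> cvg F.
Proof.
move=> FF /cauchyP Fc.
have RI (g : R[i]^o -> R) : (forall x y, `|g x - g y|%:C%C <= `|x - y|) ->
    cvg (g @ F).
  move=> gle; apply: R_complete; apply/cauchyP => e e0.
  have e0' : 0 < e%:C%C by rewrite ltcR.
  have [x Fx] := Fc _ e0'; exists (g x).
  suff : F (g @^-1` ball (g x) e) by [].
  apply: filterS Fx => y.
  rewrite -!ball_normE /= => xy.
  by rewrite -ltcR (le_lt_trans (gle x y)).
have /cvg_ex[/= a Fa] : cvg ((@complex.Re R : R[i]^o -> R) @ F).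
  by apply: RI => x y; rewrite -raddfB; exact: normc_ge_Re.
have /cvg_ex[/= b Fb] : cvg ((@complex.Im R : R[i]^o -> R) @ F).
  apply: RI => x y.
  rewrite -raddfB; exact: complex_ge_Im.
apply/cvg_ex; exists (a +i* b)%C; apply/cvgrPdist_lt => e e0.
have ee : e = (complex.Re e)%:C%C.
  by move: e0; case: e => u v; rewrite ltcE/= => /andP[/eqP-> _].
have r0 : 0 < complex.Re e / 2 by rewrite divr_gt0// -ltcR -ee.
move/cvgrPdist_lt/(_ _ r0) : Fa => Fa.
move/cvgrPdist_lt/(_ _ r0) : Fb => Fb.
near=> x.
have xa : `|a - complex.Re x| < complex.Re e / 2 by near: x.
have xb : `|b - complex.Im x| < complex.Re e / 2 by near: x.
rewrite ee.
have -> : (a +i* b)%C - x = (a - complex.Re x)%:C%C + (0 +i* (b - complex.Im x))%C.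
  by case: (x) => u v /=; apply/eqP; rewrite eq_complex /= !(addr0, add0r, subr0) !eqxx.
apply: (le_lt_trans (ler_normD _ _)).
rewrite !normc_def /= expr0n /= addr0 add0r !sqrtr_sqr -rmorphD /= ltcR.
by rewrite [ltRHS]splitr ltrD.
Unshelve. all: by end_near. Qed.

HB.instance Definition _ (R : realType) :=
  NumField_isScalarField.Build R[i]
    (@complex_scalar_sup R) (@complex_scalar_complete R).

(* Algebras are not assumed to be unital, so MathComp's ring structures, which
   all have a unit, do not apply. *)
HB.mixin Record isBanachAlgebra (K : scalarFieldType) A
    & CompleteNormedModule K A := {
  bmul : A -> A -> A;
  bmulA : associative bmul;
  linear_bmull : forall b, linear (bmul^~ b);
  linear_bmulr : forall a, linear (bmul a);
  ler_norm_bmul : forall a b, `|bmul a b| <= `|a| * `|b|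
}.

#[short(type="banachAlgType")]
HB.structure Definition BanachAlgebra (K : scalarFieldType) :=
  {A of CompleteNormedModule K A & isBanachAlgebra K A}.

(* lact a x is a . x and ract x a is x . a; both are jointly continuous. *)
HB.mixin Record isBanachBimodule (K : scalarFieldType) (A : banachAlgType K) X
    & CompleteNormedModule K X := {
  lact : A -> X -> X;
  ract : X -> A -> X;
  linear_lactl : forall x, linear (lact^~ x);
  linear_lactr : forall a, linear (lact a);
  linear_ractl : forall a, linear (ract^~ a);
  linear_ractr : forall x, linear (ract x);
  lactA : forall a b x, lact (bmul a b) x = lact a (lact b x);
  ractA : forall x a b, ract x (bmul a b) = ract (ract x a) b;
  lract : forall a x b, ract (lact a x) b = lact a (ract x b);
  lact_continuous : continuous (fun p : A * X => lact p.1 p.2);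
  ract_continuous : continuous (fun p : X * A => ract p.1 p.2)
}.

#[short(type="banachBimodType")]
HB.structure Definition BanachBimodule (K : scalarFieldType)
    (A : banachAlgType K) :=
  {X of CompleteNormedModule K X & isBanachBimodule K A X}.

(* The topological dual of X: bounded linear functionals with the operator norm.
   K^o is K regarded as a normed space over itself. *)
Section dual.
Variables (K : scalarFieldType) (X : normedModType K).

Definition dual_pred : {pred X -> K^o} :=
  fun f => `[< linear f /\ continuous f >].

Lemma dual_submod_closed : submod_closed dual_pred.
Proof.
split.
  rewrite unfold_in; apply/asboolP; split; last by move=> x; exact: cvg_cst.
  by move=> a x y; rewrite -[LHS]/0 -[X in a *: X + _]/0 -[X in _ + X]/0 scaler0 addr0.
move=> a f g; rewrite !unfold_in => /asboolP[lf cf] /asboolP[lg cg].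
apply/asboolP; split.
  move=> b x y; rewrite !fctE /= lf lg !scalerDr !scalerA (mulrC a b) -!addrA.
  by congr (_ + _); rewrite addrCA.
move=> x; apply: cvgD; last exact: cg.
by apply: cvgZr; exact: cf.
Qed.

HB.instance Definition _ :=
  GRing.isSubmodClosed.Build K (X -> K^o) dual_pred dual_submod_closed.

Record dual := Dual { dual_fun :> X -> K^o; dual_funP : dual_fun \in dual_pred }.

HB.instance Definition _ := [isSub for dual_fun].
HB.instance Definition _ := [Choice of dual by <:].
HB.instance Definition _ := [SubChoice_isSubLmodule of dual by <:].

Lemma dual_linear (f : dual) : linear f.
Proof. by have := dual_funP f; rewrite unfold_in => /asboolP[]. Qed.

Lemma dual_continuous (f : dual) : continuous f.
Proof. by have := dual_funP f; rewrite unfold_in => /asboolP[]. Qed.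

Lemma dual_bounded (f : dual) :
  exists2 M : K, 0 <= M & forall x, `|f x| <= M * `|x|.
Proof.
pose g : {linear X -> K^o} := HB.pack (f : X -> K^o)
  (GRing.isLinear.Build _ _ _ _ (f : X -> K^o) (@dual_linear f)).
have /linear_bounded_continuous/linear_boundedP : continuous g.
  exact: dual_continuous.
by case/pinfty_ex_gt0 => M M0 gM; exists M => //; exact: ltW.
Qed.

Lemma bounded_dual_pred (f : X -> K^o) (M : K) : linear f ->
  (forall x, `|f x| <= M * `|x|) -> f \in dual_pred.
Proof.
move=> lf fM; rewrite unfold_in; apply/asboolP; split=> //.
pose g : {linear X -> K^o} := HB.pack f (GRing.isLinear.Build _ _ _ _ f lf).
apply: (@bounded_linear_continuous _ _ _ g); apply/linear_boundedP.
near=> r => x.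
have Mx : M * `|x| = `|M| * `|x|.
  by rewrite -[in RHS](normr_id x) -normrM ger0_norm// (le_trans _ (fM x)).
apply: (le_trans (fM x)); rewrite Mx; apply: ler_wpM2r => //.
Unshelve. all: by end_near. Qed.

(* supremum x0 S is the least upper bound of S when it exists, x0 otherwise; it
   exists here by scalar_sup (see dual_norm_supremums). *)
Definition dual_norm (f : dual) : K :=
  supremum 0 [set `|f x| | x in [set x | `|x| <= 1]].

Let dualE0 (f : dual) : f 0 = 0.
Proof.
by have := @dual_linear f 1 0 0; rewrite !scale1r addr0 => /(canLR (addrK _));
   rewrite subrr.
Qed.

Let dualZ (f : dual) a x : f (a *: x) = a * f x.
Proof. by have := @dual_linear f a x 0; rewrite dualE0 !addr0. Qed.

Let dual_norm_supremums (f : dual) :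
  supremums [set `|f x| | x in [set x | `|x| <= 1]] (dual_norm f).
Proof.
set S := [set _ | _ in _].
have S0 : S 0 by exists 0; rewrite /= ?dualE0 ?normr0.
have [M M0 fM] := dual_bounded f.
have [s Ss] : supremums S !=set0.
  apply: scalar_sup; first by move=> _ [x _ <-].
    by exists 0.
  exists M => _ [x /= x1 <-]; apply: (le_trans (fM x)).
  by rewrite -[leRHS]mulr1 ler_wpM2l.
rewrite /dual_norm /supremum ifF; first exact: xgetI Ss.
by apply/negbTE/set0P; exists 0.
Qed.

Lemma dual_norm_ge0 (f : dual) : 0 <= dual_norm f.
Proof.
apply: (proj1 (dual_norm_supremums f)).
by exists 0; rewrite /= ?dualE0 ?normr0.
Qed.

Lemma ler_dual_norm (f : dual) x : `|f x| <= dual_norm f * `|x|.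
Proof.
have [->|x0] := eqVneq x 0; first by rewrite dualE0 !normr0 mulr0.
have xp : 0 < `|x| by rewrite normr_gt0.
rewrite -ler_pdivrMr// -[X in _ / X]normr_id mulrC -normfV -normrM -dualZ.
apply: (proj1 (dual_norm_supremums f)); exists (`|x|^-1 *: x) => //=.
by rewrite normrZ normfV normr_id mulVf// gt_eqF.
Qed.

Lemma dual_norm_le (f : dual) M : 0 <= M ->
  (forall x, `|f x| <= M * `|x|) -> dual_norm f <= M.
Proof.
move=> M0 fM; apply: (proj2 (dual_norm_supremums f)) => _ [x /= x1 <-].
by apply: (le_trans (fM x)); rewrite -[leRHS]mulr1 ler_wpM2l.
Qed.

Let dual_normD (f g : dual) : dual_norm (f + g) <= dual_norm f + dual_norm g.
Proof.
apply: dual_norm_le => [|x]; first by rewrite addr_ge0 ?dual_norm_ge0.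
rewrite mulrDl; apply: (le_trans (ler_normD _ _)).
by rewrite lerD ?ler_dual_norm.
Qed.

Let dual_normZ_le (l : K) (f : dual) : dual_norm (l *: f) <= `|l| * dual_norm f.
Proof.
apply: dual_norm_le => [|x]; first by rewrite mulr_ge0 ?dual_norm_ge0.
rewrite -mulrA -[X in `|X|]/(l * f x) normrM.
by rewrite ler_wpM2l ?ler_dual_norm.
Qed.

Let dual_normZ (l : K) (f : dual) : dual_norm (l *: f) = `|l| * dual_norm f.
Proof.
apply/eqP; rewrite eq_le dual_normZ_le /=.
have [->|l0] := eqVneq l 0; first by rewrite normr0 mul0r dual_norm_ge0.
rewrite -ler_pdivlMl ?normr_gt0// -normfV.
by rewrite -{1}[f]scale1r -(mulVf l0) -scalerA.
Qed.

Let dual_norm0_eq0 (f : dual) : dual_norm f = 0 -> f = 0.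
Proof.
move=> f0; apply: val_inj; apply/funext => x /=.
apply/eqP; rewrite -normr_eq0 eq_le normr_ge0 andbT.
by have := ler_dual_norm f x; rewrite f0 mul0r.
Qed.

HB.instance Definition _ :=
  Lmodule_isNormed.Build K dual dual_normD dual_normZ dual_norm0_eq0.

Lemma dual_normE (f : dual) : `|f| = dual_norm f.
Proof. by []. Qed.

Lemma dual_complete (F : set_system dual) :
  ProperFilter F -> cauchy F -> cvg F.
Proof.
move=> FF /cauchyP Fc.
have ev x : cvg ((fun f : dual => f x : K^o) @ F).
  apply: scalar_complete; apply/cauchyP => e e0.
  have x1 : 0 < `|x| + 1 by rewrite ltr_wpDl.
  have [f Ff] := Fc _ (divr_gt0 e0 x1); exists (f x).
  suff : F ((fun f : dual => f x : K^o) @^-1` ball (f x : K^o) e) by [].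
  apply: filterS Ff => g; rewrite -!ball_normE /= => fg.
  rewrite -[X in `|X|]/((f - g) x).
  apply: (le_lt_trans (ler_dual_norm _ _)); rewrite -dual_normE.
  apply: (@le_lt_trans _ _ (`|f - g| * (`|x| + 1))).
    by rewrite ler_wpM2l ?lerDl.
  by rewrite -ltr_pdivlMr.
pose g x : K^o := lim ((fun f : dual => f x : K^o) @ F).
have gP x : (fun f : dual => f x : K^o) @ F --> g x by exact: ev.
have lg : linear g.
  move=> a x y; apply: cvg_lim => //.
  have -> : (fun f : dual => f (a *: x + y) : K^o) =
            (fun f : dual => a *: (f x : K^o) + f y).
    by apply/funext => f; rewrite dual_linear.
  by apply: cvgD; [apply: cvgZr; exact: gP|exact: gP].
have gle (e : K) (f : dual) x : F (ball f e) -> `|g x - f x| <= e * `|x|.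
  move=> Ff; apply/ler_addgt0Pr => d d0.
  have [h [fh gh]] : exists h : dual, ball f e h /\ `|g x - h x| < d.
    apply: (@filter_ex _ F); apply: filterI => //.
    by move/cvgrPdist_lt : (gP x); exact.
  rewrite -[_ - _](subrKA (h x)) addrC; apply: (le_trans (ler_normD _ _)).
  rewrite lerD ?(ltW gh)//.
  rewrite distrC -[X in `|X|]/((f - h) x).
  apply: (le_trans (ler_dual_norm _ _)); rewrite -dual_normE ler_wpM2r//.
  by move: fh; rewrite -ball_normE => /ltW.
have [f1 /gle gf1] := Fc 1 ltr01.
have gdual : g \in dual_pred.
  apply: (@bounded_dual_pred _ (1 + `|f1|)) => // x.
  rewrite -[g x](subrK (f1 x)) mulrDl; apply: (le_trans (ler_normD _ _)).
  by rewrite lerD ?gf1 ?ler_dual_norm.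
apply/cvg_ex; exists (Dual gdual); apply/cvgrPdist_lt => e e0.
have [f Ff] := Fc _ (divr_gt0 e0 (ltr0n _ 2)).
apply: filterS (Ff) => h; rewrite -ball_normE /= => fh.
rewrite -[_ - h](subrKA f) [ltRHS]splitr; apply: (le_lt_trans (ler_normD _ _)).
rewrite ler_ltD// dual_normE; apply: dual_norm_le => [|x].
  by rewrite divr_ge0 ?ltW.
exact: gle.
Qed.

HB.instance Definition _ := Uniform_isComplete.Build dual dual_complete.

End dual.

Section bilinear.
Variables (K : numFieldType) (V W U : normedModType K) (B : V -> W -> U).
Hypotheses (Bl : forall w, linear (B^~ w)) (Br : forall v, linear (B v)).

Let B0l w : B 0 w = 0.
Proof.
have := Bl w 1 0 0; rewrite !scale1r addr0 => /(canLR (addrK _)).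
by rewrite subrr.
Qed.

Let B0r v : B v 0 = 0.
Proof.
have := Br v 1 0 0; rewrite !scale1r addr0 => /(canLR (addrK _)).
by rewrite subrr.
Qed.

Let BZl a v w : B (a *: v) w = a *: B v w.
Proof. by have := Bl w a v 0; rewrite !addr0 B0l addr0. Qed.

Let BZr a v w : B v (a *: w) = a *: B v w.
Proof. by have := Br v a w 0; rewrite !addr0 B0r addr0. Qed.

Let BBl v v' w : B (v - v') w = B v w - B v' w.
Proof. by have := Bl w (-1) v' v; rewrite !scaleN1r !(addrC (- _)). Qed.

Let BBr v w w' : B v (w - w') = B v w - B v w'.
Proof. by have := Br v (-1) w' w; rewrite !scaleN1r !(addrC (- _)). Qed.

Lemma continuous_bilinear_bounded : continuous (fun p : V * W => B p.1 p.2) ->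
  exists2 M : K, 0 <= M & forall v w, `|B v w| <= M * `|v| * `|w|.
Proof.
move=> /(_ (0, 0)); rewrite /continuous_at /= B0l => /cvgrPdist_lt/(_ _ ltr01).
move=> /nbhs_ballP[e /= e0 eB].
have [c c0 ce] : exists2 c, 0 < c & c < e.
  by exists (e / 2); [rewrite divr_gt0|rewrite gtr_pMr// invf_lt1// ltr1n].
exists (c^-1 ^+ 2) => [|v w]; first by rewrite exprn_ge0// invr_ge0 ltW.
have [->|v0] := eqVneq v 0; first by rewrite B0l !normr0 mulr0 mul0r.
have [->|w0] := eqVneq w 0; first by rewrite B0r !normr0 mulr0.
have small (T : normedModType K) (t : T) : t != 0 ->
    ball (0 : T) e ((c / `|t|) *: t).
  move=> t0; rewrite -ball_normE /= sub0r normrN normrZ normrM normfV normr_id.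
  by rewrite divfK ?normr_eq0// gtr0_norm.
have /= := eB ((c / `|v|) *: v, (c / `|w|) *: w)
  (conj (small _ _ v0) (small _ _ w0)).
rewrite sub0r normrN BZl BZr scalerA normrZ => /ltW.
rewrite !normrM !normfV !normr_id (gtr0_norm c0) => H.
have v1 : 0 < `|v| by rewrite normr_gt0.
have w1 : 0 < `|w| by rewrite normr_gt0.
rewrite -(ler_pM2l (_ : 0 < c / `|v| * (c / `|w|))); last first.
  by rewrite mulr_gt0// divr_gt0.
apply: (le_trans H).
by rewrite le_eqVlt; apply/orP; left; apply/eqP; field; rewrite !gt_eqF.
Qed.

Lemma bounded_bilinear_continuous (M : K) : 0 <= M ->
  (forall v w, `|B v w| <= M * `|v| * `|w|) ->
  continuous (fun p : V * W => B p.1 p.2).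
Proof.
move=> M0 BM [v w]; apply/cvgrPdist_lt => e e0 /=.
pose d := e / (M * (`|w| + 1 + `|v|) + 1).
have D0 : 0 < M * (`|w| + 1 + `|v|) + 1.
  by rewrite ltr_wpDl// mulr_ge0// !addr_ge0.
have d0 : 0 < d by rewrite divr_gt0.
near=> p.
have pv : `|v - p.1| < d.
  near: p; apply: (@cvgr_dist_lt _ _ _ (nbhs (v, w)) _ fst v) => //.
  exact: cvg_fst.
have pw : `|w - p.2| < d.
  near: p; apply: (@cvgr_dist_lt _ _ _ (nbhs (v, w)) _ snd w) => //.
  exact: cvg_snd.
have pw1 : `|p.2| <= `|w| + 1.
  have : `|w - p.2| < 1.
    near: p; apply: (@cvgr_dist_lt _ _ _ (nbhs (v, w)) _ snd w) => //.
    exact: cvg_snd.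
  move=> /ltW wp1; rewrite -[p.2](subrK w) addrC.
  by rewrite (le_trans (ler_normD _ _))// lerD2l distrC.
have -> : B v w - B p.1 p.2 = B (v - p.1) p.2 + B v (w - p.2).
  by rewrite BBl BBr [RHS]addrC subrKA.
apply: (le_lt_trans (ler_normD _ _)).
apply: (@le_lt_trans _ _ (M * d * (`|w| + 1) + M * `|v| * d)).
  rewrite lerD// (le_trans (BM _ _))//.
    by rewrite ler_pM// ?mulr_ge0// ler_wpM2l// ltW.
  by rewrite ler_wpM2l ?mulr_ge0// ltW.
rewrite -[ltRHS](divfK (lt0r_neq0 D0)) -/d.
rewrite (_ : _ + _ = d * (M * (`|w| + 1 + `|v|))); last by ring.
by rewrite ltr_pM2l// ltrDl.
Unshelve. all: by end_near. Qed.

End bilinear.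

Section dual_bimodule.
Variables (K : scalarFieldType) (A : banachAlgType K) (X : banachBimodType A).

Lemma lact_bounded : exists2 M : K, 0 <= M &
  forall (a : A) (x : X), `|lact a x| <= M * `|a| * `|x|.
Proof.
apply: continuous_bilinear_bounded; [exact: linear_lactl|exact: linear_lactr|].
exact: lact_continuous.
Qed.

Lemma ract_bounded : exists2 M : K, 0 <= M &
  forall (x : X) (a : A), `|ract x a| <= M * `|x| * `|a|.
Proof.
apply: continuous_bilinear_bounded; [exact: linear_ractl|exact: linear_ractr|].
exact: ract_continuous.
Qed.

Lemma dual_lact_subproof (a : A) (f : dual X) :
  (fun x : X => f (ract x a)) \in @dual_pred K X.
Proof.
have [M M0 XM] := ract_bounded.
apply: (@bounded_dual_pred _ _ _ (`|f| * (M * `|a|))) => [k x y|x].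
  by rewrite linear_ractl dual_linear.
apply: (le_trans (ler_dual_norm _ _)).
by rewrite -dual_normE -[leRHS]mulrA ler_wpM2l// mulrAC.
Qed.

Definition dual_lact (a : A) (f : dual X) : dual X :=
  Dual (dual_lact_subproof a f).

Lemma dual_ract_subproof (f : dual X) (a : A) :
  (fun x : X => f (lact a x)) \in @dual_pred K X.
Proof.
have [M M0 XM] := lact_bounded.
apply: (@bounded_dual_pred _ _ _ (`|f| * (M * `|a|))) => [k x y|x].
  by rewrite linear_lactr dual_linear.
apply: (le_trans (ler_dual_norm _ _)).
by rewrite -dual_normE -[leRHS]mulrA ler_wpM2l.
Qed.

Definition dual_ract (f : dual X) (a : A) : dual X :=
  Dual (dual_ract_subproof f a).

Let dual_eq (f g : dual X) : (forall x, f x = g x) -> f = g.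
Proof. by move=> fg; apply: val_inj; apply/funext. Qed.

Let linear_dual_lactl f : linear (dual_lact^~ f).
Proof.
by move=> k a b; apply: dual_eq => x /=; rewrite linear_ractr dual_linear.
Qed.

Let linear_dual_lactr a : linear (dual_lact a).
Proof. by move=> k f g; exact: dual_eq. Qed.

Let linear_dual_ractl a : linear (dual_ract^~ a).
Proof. by move=> k f g; exact: dual_eq. Qed.

Let linear_dual_ractr f : linear (dual_ract f).
Proof.
by move=> k a b; apply: dual_eq => x /=; rewrite linear_lactl dual_linear.
Qed.

Let dual_lactA a b f : dual_lact (bmul a b) f = dual_lact a (dual_lact b f).
Proof. by apply: dual_eq => x /=; rewrite ractA. Qed.

Let dual_ractA f a b : dual_ract f (bmul a b) = dual_ract (dual_ract f a) b.
Proof. by apply: dual_eq => x /=; rewrite lactA. Qed.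

Let dual_lract a f b :
  dual_ract (dual_lact a f) b = dual_lact a (dual_ract f b).
Proof. by apply: dual_eq => x /=; rewrite lract. Qed.

Let dual_lact_continuous :
  continuous (fun p : A * dual X => dual_lact p.1 p.2).
Proof.
have [M M0 XM] := ract_bounded.
apply: (@bounded_bilinear_continuous _ _ _ _ dual_lact _ _ M) => // a f.
apply: dual_norm_le => [|x]; first by rewrite !mulr_ge0.
apply: (le_trans (ler_dual_norm f _)).
rewrite -dual_normE (_ : M * _ * _ * _ = `|f| * (M * `|x| * `|a|)); last by ring.
by rewrite ler_wpM2l.
Qed.

Let dual_ract_continuous :
  continuous (fun p : dual X * A => dual_ract p.1 p.2).
Proof.
have [M M0 XM] := lact_bounded.
apply: (@bounded_bilinear_continuous _ _ _ _ dual_ract _ _ M) => // f a.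
apply: dual_norm_le => [|x]; first by rewrite !mulr_ge0.
apply: (le_trans (ler_dual_norm f _)).
rewrite -dual_normE (_ : M * _ * _ * _ = `|f| * (M * `|a| * `|x|)); last by ring.
by rewrite ler_wpM2l.
Qed.

HB.instance Definition _ := isBanachBimodule.Build K A (dual X)
  linear_dual_lactl linear_dual_lactr linear_dual_ractl linear_dual_ractr
  dual_lactA dual_ractA dual_lract dual_lact_continuous dual_ract_continuous.

End dual_bimodule.

Section biderivations.
Variables (K : scalarFieldType) (A : banachAlgType K) (X : banachBimodType A).

Definition derivation (d : A -> X) : Prop :=
  [/\ linear d,
      exists M : K, forall a, `|d a| <= M * `|a|
    & forall a b, d (bmul a b) = ract (d a) b + lact a (d b)].

Definition biderivation (D : A -> A -> X) : Prop :=
  [/\ (forall b, linear (D^~ b)) /\ (forall a, linear (D a)),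
      exists M : K, forall a b, `|D a b| <= M * `|a| * `|b|
    & (forall a, derivation (D a)) /\ (forall b, derivation (D^~ b))].

Definition bimod_center : set X := [set x | forall a : A, lact a x = ract x a].

Definition inner_biderivation (x : X) (a b : A) : X :=
  ract x (bmul a b - bmul b a).

End biderivations.

Definition biamenable (K : scalarFieldType) (A : banachAlgType K) : Prop :=
  forall (X : banachBimodType A) (D : A -> A -> dual X),
    biderivation D ->
    exists2 phi : dual X,
      bimod_center phi & forall a b, D a b = inner_biderivation phi a b.

(* Main.v *)
(* Let A act on X := A^* by zero on the left and by f . a := f (a -) on the
   right. On X^* = A^** only the left action survives, so for T : A -> A -> A
   bilinear, bounded and A-linear in each variable, (a, b) |-> T a b, viewed in
   A^**, is a biderivation. When A^2 <> 0 take T to be the product, which is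
   A-linear in its second variable by commutativity; when A^2 = 0 take
   T a b := f a *: b for any functional f != 0. Inner biderivations into X^*
   vanish, whereas these do not, as A^* separates the points of A. The latter is
   Hahn-Banach, obtained from Zorn's lemma applied to sublinear functions: a
   minimal one is linear. *)
From HB Require Import structures.
Require Import Defs.
From mathcomp Require Import all_boot all_order all_algebra complex.
From mathcomp Require Import all_classical all_reals all_analysis.
From mathcomp Require Import ring lra.

Import Order.TTheory GRing.Theory Num.Theory.
Import numFieldNormedType.Exports.

Local Open Scope ring_scope.

(** * Sublinear functions and the real Hahn-Banach theorem *)

Section sublinear.
Variables (R : realType) (V : lmodType R).

Definition sublinear (q : V -> R) : Prop :=
  (forall x y, q (x + y) <= q x + q y) /\
  (forall (c : R) x, 0 <= c -> q (c *: x) <= c * q x).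

Lemma sublinear0 (q : V -> R) : sublinear q -> q 0 = 0.
Proof.
move=> [qD qZ]; apply/eqP; rewrite eq_le.
have := qZ 0 0 (lexx 0); rewrite scale0r mul0r => ->.
by have := qD 0 0; rewrite addr0; lra.
Qed.

Lemma sublinearZ (q : V -> R) (c : R) x :
  sublinear q -> 0 <= c -> q (c *: x) = c * q x.
Proof.
move=> sq; rewrite le_eqVlt => /predU1P[<-|c0].
  by rewrite scale0r mul0r sublinear0.
apply/eqP; rewrite eq_le (sq.2 c x (ltW c0))/= -ler_pdivlMl//.
by rewrite -{1}[x]scale1r -(mulVf (lt0r_neq0 c0)) -scalerA sq.2// invr_ge0 ltW.
Qed.

Lemma sublinear_geN (q : V -> R) x : sublinear q -> - q (- x) <= q x.
Proof.
by move=> sq; have := sq.1 x (- x); rewrite subrr sublinear0//; lra.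
Qed.

(** [inf] is meaningful only on nonempty sets bounded below, hence the minorants [l] further
    down. *)
Definition pointwise_inf (F : set (V -> R)) (x : V) : R :=
  inf [set f x | f in F]%classic.

Lemma pointwise_inf_le (F : set (V -> R)) (l : V -> R) f x :
  (forall g, F g -> l x <= g x) -> F f -> pointwise_inf F x <= f x.
Proof.
move=> lF Ff; apply: ge_inf; last by exists f.
by exists (l x) => _ [g Fg <-]; exact: lF.
Qed.

Lemma le_pointwise_inf (F : set (V -> R)) m x : (F !=set0)%classic ->
  (forall g, F g -> m <= g x) -> m <= pointwise_inf F x.
Proof.
move=> [f Ff] mF; apply: lb_le_inf; first by exists (f x), f.
by move=> _ [g Fg <-]; exact: mF.
Qed.

(* F need not consist of sublinear functions: sublinear_shift applies this to
   translates of one. *)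
Lemma sublinear_pointwise_inf (F : set (V -> R)) (l : V -> R) :
  (F !=set0)%classic -> (forall f x, F f -> l x <= f x) ->
  (exists2 f, F f & f 0 <= 0) ->
  (forall f g x y, F f -> F g ->
    exists2 h, F h & h (x + y) <= f x + g y) ->
  (forall f (c : R) x, F f -> 0 < c ->
    exists2 h, F h & h (c *: x) <= c * f x) ->
  sublinear (pointwise_inf F).
Proof.
move=> F0 lF [f0 Ff0 f00] FD FZ.
have infle f x : F f -> pointwise_inf F x <= f x.
  by move=> Ff; apply: (@pointwise_inf_le _ l) => // g; exact: lF.
split=> [x y|c x].
  rewrite -lerBlDr; apply: le_pointwise_inf => // f Ff.
  rewrite lerBlDr -lerBlDl; apply: le_pointwise_inf => // g Fg.
  rewrite lerBlDl; have [h Fh] := FD _ _ x y Ff Fg.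
  by apply: le_trans; exact: infle.
rewrite le_eqVlt => /predU1P[<-|c0].
  by rewrite scale0r mul0r (le_trans (infle _ _ Ff0)).
rewrite -ler_pdivrMl//; apply: le_pointwise_inf => // f Ff.
rewrite ler_pdivrMl//; have [h Fh] := FZ _ _ x Ff c0.
by apply: le_trans; exact: infle.
Qed.

(** For sublinear [q] the infimum of this family is at most [q x] (take [t = 0]) and at most
    [q (x + y) - q y] (take [t = 1]); for a minimal [q] the two give additivity. *)
Definition shift_family (q : V -> R) (y : V) : set (V -> R) :=
  [set (fun x => q (x + t *: y) - t * q y) | t in [set t : R | 0 <= t]]%classic.

(** Subadditivity for [t *: y = (x + t *: y) + (- x)]. The bound does not depend on [t], so the
    infimum is finite. *)
Lemma shift_family_ge (q : V -> R) y f x : sublinear q ->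
  shift_family q y f -> - q (- x) <= f x.
Proof.
move=> sq [t /= t0 <-]; rewrite -sublinearZ//.
by have := sq.1 (x + t *: y) (- x); rewrite addrAC subrr add0r; lra.
Qed.

Lemma sublinear_shift (q : V -> R) y : sublinear q ->
  sublinear (pointwise_inf (shift_family q y)).
Proof.
move=> sq.
have F0 : shift_family q y q.
  exists 0; rewrite /= ?lexx//; apply/funext => x.
  by rewrite scale0r mul0r addr0 subr0.
apply: (@sublinear_pointwise_inf _ (fun x => - q (- x))).
- by exists q.
- by move=> f x; exact: shift_family_ge.
- by exists q => //; rewrite sublinear0.
- move=> _ _ x z [t /= t0 <-] [s /= s0 <-].
  (* The parameters of the two members add up; under scaling by [c], [t] becomes [c * t]. *)
  exists (fun x => q (x + (t + s) *: y) - (t + s) * q y).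
    by exists (t + s); rewrite /= ?addr_ge0.
  rewrite scalerDl addrACA mulrDl.
  by have := sq.1 (x + t *: y) (z + s *: y); lra.
- move=> _ c x [t /= t0 <-] c0.
  exists (fun x => q (x + (c * t) *: y) - (c * t) * q y).
    by exists (c * t) => //=; exact: mulr_ge0 (ltW c0) t0.
  by rewrite -scalerA -scalerDr mulrBr mulrA lerD2r sq.2// ltW.
Qed.

Lemma shift_le (q : V -> R) (y x : V) (t : R) : sublinear q -> 0 <= t ->
  pointwise_inf (shift_family q y) x <= q (x + t *: y) - t * q y.
Proof.
move=> sq t0.
apply: (@pointwise_inf_le _ (fun x => - q (- x))
  (fun x => q (x + t *: y) - t * q y)).
  by move=> g; exact: shift_family_ge.
by exists t.
Qed.

(** Zorn's lemma: a nonempty chain is bounded by its pointwise infimum, which is again sublinear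
    because of two members the smaller serves both arguments. *)
Lemma exists_minimal_sublinear (p : V -> R) : sublinear p ->
  exists q, [/\ sublinear q, forall x, q x <= p x
    & forall r, sublinear r -> (forall x, r x <= q x) ->
      forall x, q x <= r x].
Proof.
move=> sp.
pose P q := sublinear q /\ forall x : V, q x <= p x.
pose T := {q | P q}.
have Pp : P p by [].
(* The order is reversed, so that maximal elements are minimal functions. *)
pose le_T (q r : T) := `[< forall x, sval r x <= sval q x >].
have [||A totA|[q [sq qp]] qmin] := @ZL_preorder T (exist P p Pp) le_T.
- by move=> t; apply/asboolP => x.
- move=> r s t /asboolP rs /asboolP st; apply/asboolP => x.
  exact: le_trans (st x) (rs x).
- have [[a Aa]|A0] := pselect (A !=set0)%classic; last first.
    exists (exist P p Pp) => s As.
    by case: A0; exists s.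
  pose F := [set sval q | q in A]%classic.
  (* From [q <= p]: [- p (- x) <= - q (- x) <= q x], a minorant common to the whole chain. *)
  have lF f x : F f -> - p (- x) <= f x.
    move=> [[q [sq qp]] Aq <-] /=.
    by rewrite (le_trans _ (sublinear_geN _ _ sq))// lerN2.
  have Fle f x : F f -> pointwise_inf F x <= f x.
    move=> Ff; apply: (@pointwise_inf_le _ (fun x => - p (- x))) => // g.
    exact: lF.
  have sF : sublinear (pointwise_inf F).
    apply: (@sublinear_pointwise_inf _ (fun x => - p (- x))) => //.
    + by exists (sval a), a.
    + exists (sval a); first by exists a.
      by rewrite sublinear0//; case: (svalP a).
    + move=> _ _ x y [q Aq <-] [r Ar <-].
      have [sq _] := svalP q; have [sr _] := svalP r.
      have [/asboolP qr|/asboolP rq] := totA _ _ Aq Ar.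
        exists (sval r); first by exists r.
        by rewrite (le_trans (sr.1 _ _))// lerD2r.
      exists (sval q); first by exists q.
      by rewrite (le_trans (sq.1 _ _))// lerD2l.
    + move=> _ c x [q Aq <-] c0; exists (sval q); first by exists q.
      by have [sq _] := svalP q; apply: sq.2; exact: ltW.
  have Fp x : pointwise_inf F x <= p x.
    apply: (@le_trans _ _ (sval a x)); first by apply: Fle; exists a.
    by case: (svalP a).
  exists (exist P _ (conj sF Fp)) => s As; apply/asboolP => x /=.
  by apply: Fle; exists s.
exists q; split=> // r sr rq x.
have rp y : r y <= p y := le_trans (rq y) (qp y).
have /asboolP := qmin (exist P r (conj sr rp)) (asboolT rq).
exact.
Qed.

(** The shift of [q] along [y] is sublinear and below [q], so minimality gives
    [q x <= q (x + y) - q y], the converse of subadditivity. Additivity makes [q] odd, which settles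
    negative scalars. *)
Lemma minimal_sublinear_linear (q : V -> R) : sublinear q ->
  (forall r, sublinear r -> (forall x, r x <= q x) -> forall x, q x <= r x) ->
  linear (q : V -> R^o).
Proof.
move=> sq qmin.
have qD x y : q (x + y) = q x + q y.
  apply/eqP; rewrite eq_le sq.1 /= -lerBrDr.
  have := shift_le _ y x _ sq ler01; rewrite scale1r mul1r; apply: le_trans.
  apply: qmin; first exact: sublinear_shift.
  move=> z; have := shift_le _ y z _ sq (lexx 0).
  by rewrite scale0r mul0r addr0 subr0.
have qN x : q (- x) = - q x.
  by apply/eqP; rewrite -addr_eq0 -qD addNr sublinear0.
move=> c x y; rewrite qD; congr (_ + _).
have [c0|/ltW c0] := leP 0 c; first exact: sublinearZ.
rewrite -[c]opprK scaleNr qN sublinearZ// ?oppr_ge0//.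
by rewrite -mulNr.
Qed.

(** No functional is extended from a subspace: shifting [p] along [v] before minimizing forces
    [f (- v) <= p 0 - p v = - p v], hence [p v <= f v]. *)
Theorem hahn_banach (p : V -> R) (v : V) : sublinear p ->
  exists f : V -> R^o, [/\ linear f, forall x, f x <= p x & f v = p v].
Proof.
move=> sp.
have [f [sf fq fmin]] := exists_minimal_sublinear _ (sublinear_shift p v sp).
have lf := minimal_sublinear_linear _ sf fmin.
have fp x : f x <= p x.
  have := shift_le p v x 0 sp (lexx _).
  by rewrite scale0r mul0r addr0 subr0; exact: le_trans.
exists f; split => //.
apply/eqP; rewrite eq_le fp /= -lerN2.
have := shift_le p v (- v) 1 sp ler01.
rewrite scale1r mul1r addNr sublinear0// sub0r; apply: le_trans.
apply: le_trans (fq _).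
by have := sublinear_geN _ (- v) sf; rewrite opprK; lra.
Qed.

End sublinear.

(** * Separation of points by bounded functionals, over the reals and over the complex numbers *)

Lemma real_dual_separates (R : realType) (V : normedModType R) (v : V) :
  v != 0 -> exists f : dual V, f v != 0.
Proof.
move=> v0.
have [|f [lf fp fv]] := @hahn_banach R V (fun x => `|x|) v.
  split=> [x y|c x c0]; first exact: ler_normD.
  by rewrite normrZ ger0_norm.
have fN x : f (- x) = - f x.
  have f0 : f 0 = 0.
    by have := lf 1 0 0; rewrite !scale1r addr0; lra.
  by have := lf (-1) x 0; rewrite f0 !addr0 scaleN1r => ->; rewrite scaleN1r.
have fb : f \in @dual_pred R V.
  apply: (@bounded_dual_pred _ _ _ 1) => // x.
  rewrite mul1r ler_norml fp andbT lerNl -fN.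
  by rewrite (le_trans (fp _))// normrN.
by exists (Dual fb); rewrite /= fv normr_eq0.
Qed.

Section realification.
Variables (R : realType) (V : lmodType R[i]).

(** A separate name, so that the real scalar action does not compete with the complex one on [V]. *)
Definition realification : Type := V.

HB.instance Definition _ := GRing.Zmodule.on realification.

Definition real_scale (a : R) (x : realification) : realification :=
  (a%:C%C *: (x : V)).

Lemma real_scaleA a b x :
  real_scale a (real_scale b x) = real_scale (a * b) x.
Proof. by rewrite /real_scale scalerA rmorphM. Qed.

Lemma real_scale1 : left_id 1 real_scale.
Proof. by move=> x; rewrite /real_scale scale1r. Qed.

Lemma real_scaleDr : right_distributive real_scale +%R.
Proof. by move=> a x y; rewrite /real_scale scalerDr. Qed.

Lemma real_scaleDl x : {morph real_scale^~ x : a b / a + b}.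
Proof. by move=> a b; rewrite /real_scale rmorphD scalerDl. Qed.

HB.instance Definition _ := GRing.Zmodule_isLmodule.Build R realification
  real_scaleA real_scale1 real_scaleDr real_scaleDl.

(** This is [g x - i g (i x)], the only possible complex-linear functional with real part [g];
    replacing [x] by [i x] multiplies it by [i]. *)
Lemma complexify_linear (g : realification -> R^o) : linear g ->
  linear (fun x : V => Complex (g x) (- g ('i%C *: x)) : R[i]^o).
Proof.
move=> lg.
have gD x y : g ((x : V) + y) = g x + g y.
  by have := lg 1 x y; rewrite !scale1r.
have gZ (a : R) x : g (a%:C%C *: (x : V)) = a * g x.
  have g0 : g 0 = 0 by apply: (addrI (g 0)); rewrite -gD !addr0.
  by have := lg a x 0; rewrite g0 !addr0.
move=> [a b] x y.
(* [g] commutes with real scalars only, so complex ones are split into real multiples of [1] and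
   [i]. *)
have cE : Complex a b = a%:C%C + b%:C%C * 'i%C.
  by apply/eqP; rewrite eq_complex /=; apply/andP; split; apply/eqP; ring.
have icE : 'i%C * Complex a b = a%:C%C * 'i%C + (- b)%:C%C.
  by apply/eqP; rewrite eq_complex /=; apply/andP; split; apply/eqP; ring.
rewrite scalerDr scalerA icE cE !scalerDl -!scalerA !gD !gZ.
apply/eqP; rewrite eq_complex /=; apply/andP; split; apply/eqP; ring.
Qed.

End realification.

Lemma complex_dual_separates (R : realType) (V : normedModType R[i]) (v : V) :
  v != 0 -> exists f : dual V, f v != 0.
Proof.
move=> v0.
(* The norm takes values in [R[i]]; being nonnegative it is real, so its real part loses nothing. *)
pose p (x : realification R V) : R := complex.Re `|(x : V)|.
have pE (x : V) : `|x| = (p x)%:C%C.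
  have := normr_ge0 x; rewrite /p; case: `|x| => a b.
  by rewrite lecE /= => /andP[/eqP->].
have [|g [lg gp gv]] := @hahn_banach R (realification R V) p v.
  split=> [x y|c x c0]; rewrite -lecR.
    by rewrite rmorphD /= -!pE ler_normD.
  by rewrite rmorphM /= -!pE normrZ ger0_norm// lecR.
have gN (x : realification R V) : g (- x) = - g x.
  have g0 : g 0 = 0.
    by have := lg 1 0 0; rewrite !scale1r addr0; lra.
  by have := lg (-1) x 0; rewrite g0 !addr0 scaleN1r => ->; rewrite scaleN1r.
have gle (x : V) : `|g x|%:C%C <= `|x|.
  rewrite pE lecR ler_norml gp andbT lerNl -gN.
  by rewrite (le_trans (gp _))// /p normrN.
pose f (x : V) : R[i]^o := Complex (g x) (- g ('i%C *: x)).
have fb : f \in @dual_pred R[i] V.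
  (* Both components of [f x] are bounded by the norm of [x], whence the crude constant 2. *)
  apply: (@bounded_dual_pred _ _ _ 2); first exact: complexify_linear.
  move=> x.
  have -> : f x = (g x)%:C%C - 'i%C * (g ('i%C *: x))%:C%C.
    by apply/eqP; rewrite eq_complex /=; apply/andP; split; apply/eqP; ring.
  rewrite (le_trans (ler_normB _ _))// mulr_natl mulr2n lerD//.
    by rewrite normc_def /= expr0n addr0 sqrtr_sqr.
  have -> : `|'i%C * (g ('i%C *: x))%:C%C : R[i]| = `|g ('i%C *: x)|%:C%C.
    rewrite normrM !normc_def /= !expr0n /= add0r addr0 expr1n sqrtr1 mul1r.
    by rewrite sqrtr_sqr.
  rewrite (le_trans (gle _))// normrZ.
  by rewrite normc_def /= expr0n add0r expr1n sqrtr1 mul1r.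
exists (Dual fb); rewrite /= eq_complex negb_and /= gv.
by rewrite -(inj_eq (@complexI R)) -pE normr_eq0 v0.
Qed.

(** * The dual of [A] with zero left action, and biderivations into its dual *)

Section right_dual.
Variables (K : scalarFieldType) (A : banachAlgType K).

Lemma dual_ext (X : normedModType K) (f g : dual X) :
  (forall x, f x = g x) -> f = g.
Proof. by move=> fg; apply: val_inj; apply/funext. Qed.

Lemma dual0E (X : normedModType K) (f : dual X) : f 0 = 0.
Proof.
by have := dual_linear f 1 0 0; rewrite !scale1r addr0 => /(canLR (addrK _));
   rewrite subrr.
Qed.

(** An alias, keeping this bimodule structure apart from the one carried by duals of bimodules. *)
Definition right_dual : Type := dual A.

HB.instance Definition _ := CompleteNormedModule.on right_dual.

Let zero_act (a : A) (f : right_dual) : right_dual := 0.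

Lemma right_dual_act_subproof (f : right_dual) (a : A) :
  (fun x : A => (f : dual A) (bmul a x)) \in @dual_pred K A.
Proof.
apply: (@bounded_dual_pred _ _ _ (dual_norm f * `|a|)) => [k x y|x].
  by rewrite linear_bmulr dual_linear.
apply: (le_trans (ler_dual_norm _ _)).
by rewrite -mulrA ler_wpM2l ?dual_norm_ge0// ler_norm_bmul.
Qed.

Definition right_dual_act (f : right_dual) (a : A) : right_dual :=
  Dual (right_dual_act_subproof f a).

Let zero_act_linearl f : linear (zero_act^~ f).
Proof. by move=> k a b; rewrite /zero_act scaler0 addr0. Qed.

Let zero_act_linearr a : linear (zero_act a).
Proof. by move=> k f g; rewrite /zero_act scaler0 addr0. Qed.

Let act_linearl a : linear (right_dual_act^~ a).
Proof. by move=> k f g; exact: dual_ext. Qed.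

Let act_linearr f : linear (right_dual_act f).
Proof.
by move=> k a b; apply: dual_ext => x /=; rewrite linear_bmull dual_linear.
Qed.

Let zero_actA a b f : zero_act (bmul a b) f = zero_act a (zero_act b f).
Proof. by []. Qed.

Let actA f a b :
  right_dual_act f (bmul a b) = right_dual_act (right_dual_act f a) b.
Proof. by apply: dual_ext => x /=; rewrite bmulA. Qed.

Let zero_act_act a f b :
  right_dual_act (zero_act a f) b = zero_act a (right_dual_act f b).
Proof. exact: dual_ext. Qed.

Let zero_act_continuous :
  continuous (fun p : A * right_dual => zero_act p.1 p.2).
Proof. by move=> p; exact: cvg_cst. Qed.

Let act_continuous :
  continuous (fun p : right_dual * A => right_dual_act p.1 p.2).
Proof.
apply: (@bounded_bilinear_continuous _ _ _ _ right_dual_act _ _ 1) => // f a.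
rewrite mul1r; apply: dual_norm_le => [|x]; first by rewrite mulr_ge0.
apply: (le_trans (ler_dual_norm f _)).
by rewrite -dual_normE -mulrA ler_wpM2l// ler_norm_bmul.
Qed.

HB.instance Definition _ := isBanachBimodule.Build K A right_dual
  zero_act_linearl zero_act_linearr act_linearl act_linearr
  zero_actA actA zero_act_act zero_act_continuous act_continuous.

Lemma right_dual_eval_subproof (x : A) :
  (fun f : right_dual => (f : dual A) x) \in @dual_pred K right_dual.
Proof.
apply: (@bounded_dual_pred _ _ _ `|x|) => // f.
by rewrite mulrC; exact: (ler_dual_norm (f : dual A) x).
Qed.

(** The canonical embedding of [A] into its bidual. *)
Definition right_dual_eval (x : A) : dual right_dual :=
  Dual (right_dual_eval_subproof x).

Lemma right_dual_eval_linear : linear right_dual_eval.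
Proof. by move=> k x y; apply: dual_ext => f /=; rewrite dual_linear. Qed.

Lemma ler_norm_right_dual_eval x : `|right_dual_eval x| <= `|x|.
Proof.
apply: dual_norm_le => // f.
by rewrite mulrC; exact: (ler_dual_norm (f : dual A) x).
Qed.

(** Acting by [a] on the left of a functional evaluates it at [f . a], and [(f . a) x = f (a x)]. *)
Lemma right_dual_eval_bmul (a x : A) :
  right_dual_eval (bmul a x) = lact a (right_dual_eval x).
Proof. exact: dual_ext. Qed.

(** [phi . a] evaluates [phi] at [a . f = 0]. This removes one term of the derivation rule and
    annihilates every inner biderivation. *)
Lemma dual_right_dual_ract0 (phi : dual right_dual) (a : A) : ract phi a = 0.
Proof. by apply: dual_ext => f; exact: dual0E. Qed.

(** The derivation rule into the bidual reduces to [d (c a) = c . d a], which [T] followed by the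
    embedding satisfies in each variable. *)
Lemma bimorphism_not_biamenable (T : A -> A -> A) (M : K) :
  (forall f : A, f != 0 -> exists phi : dual A, phi f != 0) ->
  (forall b, linear (T^~ b)) -> (forall a, linear (T a)) ->
  (forall a b, `|T a b| <= M * `|a| * `|b|) ->
  (forall a b c, T (bmul c a) b = bmul c (T a b)) ->
  (forall a b c, T a (bmul c b) = bmul c (T a b)) ->
  (exists a b, T a b != 0) -> ~ biamenable A.
Proof.
move=> sep Tl Tr TM TAl TAr [a [b Tab]].
move=> /(_ right_dual (fun a b => right_dual_eval (T a b))) [].
  have el c : linear (fun a => right_dual_eval (T a c)).
    by move=> k x y; rewrite Tl right_dual_eval_linear.
  have er c : linear (fun a => right_dual_eval (T c a)).
    by move=> k x y; rewrite Tr right_dual_eval_linear.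
  have eM x y : `|right_dual_eval (T x y)| <= M * `|x| * `|y|.
    exact: le_trans (ler_norm_right_dual_eval _) (TM _ _).
  split=> //; first by exists M.
  split=> c; split=> //.
  - by exists (M * `|c|).
  - by move=> x y; rewrite TAr right_dual_eval_bmul dual_right_dual_ract0 add0r.
  - by exists (M * `|c|) => x; rewrite mulrAC.
  - by move=> x y; rewrite TAl right_dual_eval_bmul dual_right_dual_ract0 add0r.
move=> phi _ /(_ a b); rewrite /inner_biderivation dual_right_dual_ract0 => e.
(* Being inner would make evaluation at [T a b] zero on all functionals, against separation of
   points. *)
have [f /negP[]] := sep _ Tab.
rewrite -[f _]/(right_dual_eval (T a b) f) e; exact/eqP.
Qed.

(** Separation of points is a hypothesis here so that the argument is uniform in [K]; real and
    complex scalars supply it separately. *)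
Lemma commutative_not_biamenable :
  commutative (@bmul K A) ->
  (forall x : A, x != 0 -> exists f : dual A, f x != 0) ->
  (exists x : A, x != 0) -> ~ biamenable A.
Proof.
move=> bmulC sep [x x0].
have [[a [b ab0]]|A2] := pselect (exists a b : A, bmul a b != 0).
  apply: (bimorphism_not_biamenable (@bmul K A) 1) => //.
  - exact: linear_bmull.
  - exact: linear_bmulr.
  - by move=> u v; rewrite mul1r ler_norm_bmul.
  - by move=> u v c; rewrite bmulA.
  - by move=> u v c; rewrite !bmulA (bmulC u).
  - by exists a, b.
have {}A2 (u v : A) : bmul u v = 0.
  by apply/eqP/negPn/negP => uv; apply: A2; exists u, v.
have [f fx] := sep _ x0.
(* When all products vanish, both sides of each [A]-linearity condition are zero, so any bounded
   bilinear map qualifies; this one is nonzero at [(x, x)]. *)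
apply: (bimorphism_not_biamenable (fun u v => f u *: v) (dual_norm f)) => //.
- by move=> v k u w; rewrite dual_linear scalerDl scalerA.
- by move=> u k v w; rewrite scalerDr !scalerA mulrC.
- by move=> u v; rewrite normrZ ler_wpM2r// ler_dual_norm.
- by move=> u v c; rewrite !A2 dual0E scale0r.
- by move=> u v c; rewrite !A2 scaler0.
- by exists x, x; rewrite scaler_eq0 negb_or fx x0.
Qed.

End right_dual.

Theorem corollary3p7 (R : realType) :
  (forall A : banachAlgType R,
     commutative (@bmul R A) -> (exists a : A, a != 0) -> ~ biamenable A) /\
  (forall A : banachAlgType R[i],
     commutative (@bmul R[i] A) -> (exists a : A, a != 0) -> ~ biamenable A).
Proof.
split=> A bmulC; apply: commutative_not_biamenable => // x.
  exact: real_dual_separates.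
exact: complex_dual_separates.
Qed.
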